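(* Let $(\mathfrak g,[\cdot,\cdot]_{\mathfrak g})$ and $(\mathfrak h,[\cdot,\cdot]_{\mathfrak h})$ be Leibniz algebras, $(\mathfrak h,\rho^L,\rho^R)$ a Leibniz $\mathfrak g$-representation, and $H:\mathfrak g\to\mathfrak h$ a crossed homomorphism. Let $H_t=\sum_{i\ge0}t^iH_i$ be a formal one-parameter deformation of $H$. Then the linear term $H_1$ is a $1$-cocycle in the cohomology of $H$. Moreover, the corresponding cohomology class in $\mathcal H^1_H(\mathfrak g,\mathfrak h)$ depends only on the equivalence class of $H_t$; that is, if $H'_t=\sum_{i\ge0}t^iH'_i$ is a formal deformation of $H$ equivalent to $H_t$, then $H_1$ and $H'_1$ define the same class in $\mathcal H^1_H(\mathfrak g,\mathfrak h)$.
   Context: All vector spaces are over a field $\mathbf k$ of characteristic $0$. A Leibniz algebra is a vector space $\mathfrak g$ with a bilinear bracket satisfying $[x,[y,z]_{\mathfrak g}]_{\mathfrak g}=[[x,y]_{\mathfrak g},z]_{\mathfrak g}+[y,[x,z]_{\mathfrak g}]_{\mathfrak g}$ for all $x,y,z$; write $L_x=[x,\cdot]_{\mathfrak g}$. A representation of $\mathfrak g$ is a vector space $V$ with linear maps $\rho^L,\rho^R:\mathfrak g\to \mathrm{End}(V)$ such that for all $x,y\in\mathfrak g$: $\rho^L([x,y]_{\mathfrak g})=\rho^L(x)\rho^L(y)-\rho^L(y)\rho^L(x)$; $\rho^R([x,y]_{\mathfrak g})=\rho^L(x)\rho^R(y)-\rho^R(y)\rho^L(x)$; $\rho^R([x,y]_{\mathfrak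 g})=\rho^L(x)\rho^R(y)+\rho^R(y)\rho^R(x)$. A Leibniz $\mathfrak g$-representation is a Leibniz algebra $\mathfrak h$ with linear maps $\rho^L,\rho^R:\mathfrak g\to\mathrm{End}(\mathfrak h)$ making $(\mathfrak h,\rho^L,\rho^R)$ a representation of $\mathfrak g$ and such that for all $h,k\in\mathfrak h$, $x\in\mathfrak g$: $\rho^L(x)[h,k]_{\mathfrak h}=[\rho^L(x)h,k]_{\mathfrak h}+[h,\rho^L(x)k]_{\mathfrak h}$; $[h,\rho^R(x)k]_{\mathfrak h}=\rho^R(x)[h,k]_{\mathfrak h}+[k,\rho^R(x)h]_{\mathfrak h}$; $[h,\rho^L(x)k]_{\mathfrak h}=[\rho^R(x)h,k]_{\mathfrak h}+\rho^L(x)[h,k]_{\mathfrak h}$. A crossed homomorphism is a linear map $H:\mathfrak g\to\mathfrak h$ with $H([x,y]_{\mathfrak g})=\rho^L(x)H(y)+\rho^R(y)H(x)+[H(x),H(y)]_{\mathfrak h}$ for all $x,y\in\mathfrak g$. A morphism from a crossed homomorphism $H$ to a crossed homomorphism $H'$ (both $\mathfrak g\to\mathfrak h$) is a pair of Leibniz algebra morphisms $\phi_{\mathfrak g}:\mathfrak g\to\mathfrak g$, $\phi_{\mathfrak h}:\mathfrak h\to\mathfrak h$ with $\phi_{\mathfrak h}\circ H=H'\circ\phi_{\mathfrak g}$, $\phi_{\mathfrak h}(\rho^L(x)h)=\rho^L(\phi_{\mathfrak g}(x))\phi_{\mathfrak h}(h)$ and $\phi_{\mathfrak h}(\rho^R(x)h)=\rho^R(\phi_{\mathfrak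 g}(x))\phi_{\mathfrak h}(h)$ for all $x\in\mathfrak g$, $h\in\mathfrak h$. The same definitions are used over the base ring $\mathbf k[[t]]$. Cohomology of $H$: put $\rho^L_H(x)h=\rho^L(x)h+[H(x),h]_{\mathfrak h}$, $\rho^R_H(x)h=\rho^R(x)h+[h,H(x)]_{\mathfrak h}$, and $C^n(\mathfrak g,\mathfrak h)=\mathrm{Hom}(\mathfrak g^{\otimes n},\mathfrak h)$ for $n\ge0$. The cohomology $\mathcal H^*_H(\mathfrak g,\mathfrak h)$ of $H$ is that of the complex $(C^*(\mathfrak g,\mathfrak h),d_H)$ with $d_H f=(-1)^{n-1}\delta_{\mathrm{Leib}}f$ for $f\in C^n(\mathfrak g,\mathfrak h)$, where $$(\delta_{\mathrm{Leib}}f)(x_1,\dots,x_{n+1})=\sum_{i=1}^n(-1)^{i+1}\rho^L_H(x_i)f(x_1,\dots,\hat x_i,\dots,x_{n+1})+(-1)^{n+1}\rho^R_H(x_{n+1})f(x_1,\dots,x_n)$$ $$+\sum_{1\le i<j\le n+1}(-1)^if(x_1,\dots,\hat x_i,\dots,x_{j-1},[x_i,x_j]_{\mathfrak g},x_{j+1},\dots,x_{n+1}).$$ For a vector space $V$, $V[[t]]$ denotes formal power series in $t$ with coefficients in $V$; $\mathfrak g[[t]]$ and $\mathfrak h[[t]]$ are Leibniz algebras over $\mathbf k[[t]]$ and $\mathfrak h[[t]]$ is a Leibniz $\mathfrak g[[t]]$-representation, with structures extended $\mathbf k[[t]]$-linearly in the evident way. A formal one-parameter deformation of $H$ is a formal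 sum $H_t=H_0+tH_1+t^2H_2+\cdots\in\mathrm{Hom}(\mathfrak g,\mathfrak h)[[t]]$ with $H_0=H$ such that $H_t:\mathfrak g[[t]]\to\mathfrak h[[t]]$ is a crossed homomorphism. Two formal deformations $H_t,H'_t$ of $H$ are equivalent if there exists $x\in\mathfrak g$ such that $\phi_t=\mathrm{id}_{\mathfrak g}+tL_x$, $\psi_t=\mathrm{id}_{\mathfrak h}+t\rho^L(x)$ form a morphism $(\phi_t,\psi_t)$ from $H_t$ to $H'_t$. *)

(* Defs.v *)
From HB Require Import structures.
From mathcomp Require Import all_boot all_algebra.
From mathcomp Require Import boolp classical_sets functions.

Set Implicit Arguments.
Unset Strict Implicit.
Unset Printing Implicit Defensive.

Import GRing.Theory.

Local Open Scope classical_set_scope.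
Local Open Scope ring_scope.

(* Everything is set up over a commutative ring, because the same notions are
   needed over a field k and over k[[t]]. *)

HB.mixin Record Lmodule_isLeibniz (R : comNzRingType) g
    of GRing.Lmodule R g := {
  bracket : g -> g -> g;
  bracket_bilinear : bilinear_for *:%R *:%R bracket;
  bracket_leibniz : forall x y z : g,
    bracket x (bracket y z) = bracket (bracket x y) z + bracket y (bracket x z)
}.

#[short(type="leibnizType")]
HB.structure Definition Leibniz (R : comNzRingType) :=
  {g of Lmodule_isLeibniz R g & GRing.Lmodule R g}.

Notation "⟦ x , y ⟧" := (bracket x y)
  (at level 0, x, y at level 99, format "⟦ x ,  y ⟧") : ring_scope.

Definition is_leibniz_morphism (R : comNzRingType) (g g' : leibnizType R)
    (phi : g -> g') : Prop :=
  linear phi /\ forall x y, phi ⟦x, y⟧ = ⟦phi x, phi y⟧.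

(* A linear map g -> End(V) is encoded as a bilinear map g -> V -> V. *)
Definition is_representation (R : comNzRingType) (g : leibnizType R)
    (V : lmodType R) (rhoL rhoR : g -> V -> V) : Prop :=
  [/\ bilinear_for *:%R *:%R rhoL,
      bilinear_for *:%R *:%R rhoR,
      forall x y v, rhoL ⟦x, y⟧ v = rhoL x (rhoL y v) - rhoL y (rhoL x v),
      forall x y v, rhoR ⟦x, y⟧ v = rhoL x (rhoR y v) - rhoR y (rhoL x v)
    & forall x y v, rhoR ⟦x, y⟧ v = rhoL x (rhoR y v) + rhoR y (rhoR x v)].

Record leibniz_rep (R : comNzRingType) (g h : leibnizType R) := LeibnizRep {
  rhoL : g -> h -> h;
  rhoR : g -> h -> h;
  leibniz_rep_is_rep : is_representation rhoL rhoR;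
  rhoL_bracket : forall x u v,
    rhoL x ⟦u, v⟧ = ⟦rhoL x u, v⟧ + ⟦u, rhoL x v⟧;
  bracket_rhoR : forall x u v,
    ⟦u, rhoR x v⟧ = rhoR x ⟦u, v⟧ + ⟦v, rhoR x u⟧;
  bracket_rhoL : forall x u v,
    ⟦u, rhoL x v⟧ = ⟦rhoR x u, v⟧ + rhoL x ⟦u, v⟧
}.

Definition is_crossed_hom (R : comNzRingType) (g h : leibnizType R)
    (rho : leibniz_rep g h) (H : g -> h) : Prop :=
  linear H /\
  forall x y, H ⟦x, y⟧ = rhoL rho x (H y) + rhoR rho y (H x) + ⟦H x, H y⟧.

Definition is_crossed_hom_morphism (R : comNzRingType) (g h : leibnizType R)
    (rho : leibniz_rep g h) (H H' : g -> h) (phig : g -> g) (phih : h -> h)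
    : Prop :=
  [/\ is_leibniz_morphism phig,
      is_leibniz_morphism phih,
      phih \o H =1 H' \o phig,
      forall x v, phih (rhoL rho x v) = rhoL rho (phig x) (phih v)
    & forall x v, phih (rhoR rho x v) = rhoR rho (phig x) (phih v)].

(* An element of Hom(g^{(x) n}, h) is a
   multilinear function of x : 'I_n -> g; indices start at 0. *)

Definition cochain (R : comNzRingType) (g h : leibnizType R) (n : nat) : Type :=
  ('I_n -> g) -> h.

Definition multilinear (R : comNzRingType) (g h : leibnizType R) (n : nat)
    (f : cochain g h n) : Prop :=
  forall (i : 'I_n) (x : 'I_n -> g),
    linear (fun y : g => f (fun j => if j == i then y else x j)).

Definition rhoLH (R : comNzRingType) (g h : leibnizType R)
    (rho : leibniz_rep g h) (H : g -> h) (x : g) (v : h) : h :=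
  rhoL rho x v + ⟦H x, v⟧.

Definition rhoRH (R : comNzRingType) (g h : leibnizType R)
    (rho : leibniz_rep g h) (H : g -> h) (x : g) (v : h) : h :=
  rhoR rho x v + ⟦v, H x⟧.

(* [lift i] skips the index i. The index i here is i - 1 in the usual 1-based
   formula, hence the sign (-1)^i in the first sum and (-1)^(i+1) in the last. *)
Definition delta_leib (R : comNzRingType) (g h : leibnizType R)
    (rho : leibniz_rep g h) (H : g -> h) (n : nat) (f : cochain g h n)
    : cochain g h n.+1 :=
  fun x : 'I_n.+1 -> g =>
    \sum_(i < n.+1 | (i < n)%N)
       (-1) ^+ i *: rhoLH rho H (x i) (f (fun k => x (lift i k)))
    + (-1) ^+ n.+1 *:
       rhoRH rho H (x ord_max) (f (fun k => x (lift ord_max k)))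
    + \sum_(i < n.+1) \sum_(j < n.+1 | (i < j)%N)
       (-1) ^+ i.+1 *:
         f (fun k => if lift i k == j then ⟦x i, x j⟧ else x (lift i k)).

(* The sign is (-1)^(n-1); the exponent n.+1 also covers n = 0. *)
Definition dH (R : comNzRingType) (g h : leibnizType R)
    (rho : leibniz_rep g h) (H : g -> h) (n : nat) (f : cochain g h n)
    : cochain g h n.+1 :=
  fun x => (-1) ^+ n.+1 *: delta_leib rho H f x.

Definition cocycles (R : comNzRingType) (g h : leibnizType R)
    (rho : leibniz_rep g h) (H : g -> h) (n : nat) : set (cochain g h n) :=
  [set f | multilinear f /\ forall x, dH rho H f x = 0].

Definition coboundaries (R : comNzRingType) (g h : leibnizType R)
    (rho : leibniz_rep g h) (H : g -> h) (n : nat) : set (cochain g h n) :=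
  match n with
  | 0 => [set (fun=> 0)]
  | m.+1 => [set dH rho H f | f in [set f : cochain g h m | multilinear f] ]
  end.

Arguments cocycles {R g h} rho H n.
Arguments coboundaries {R g h} rho H n.

(* The class of a cocycle f in H^n = Z^n / B^n, as the coset f + B^n. *)
Definition cohomology_class (R : comNzRingType) (g h : leibnizType R)
    (rho : leibniz_rep g h) (H : g -> h) (n : nat) (f : cochain g h n)
    : set (cochain g h n) :=
  [set (fun x => f x + b x) | b in coboundaries rho H n].

Definition cochain1 (R : comNzRingType) (g h : leibnizType R) (f : g -> h)
    : cochain g h 1 :=
  fun x => f (x ord0).

(* Formal power series: the coefficient of t^n of u : V[[t]] is [u n]. *)

Definition powerseries (V : Type) : Type := nat -> V.

(* [conv b u v] is the k[[t]]-bilinear extension of b to power series. *)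
Definition conv (U V : Type) (W : nmodType) (b : U -> V -> W)
    (u : powerseries U) (v : powerseries V) : powerseries W :=
  fun n => \sum_(i < n.+1) b (u i) (v (n - i)%N).

Definition constps (V : nmodType) (v : V) : powerseries V :=
  fun n => if n is 0 then v else 0.

Lemma convE (U V : Type) (W : nmodType) (b : U -> V -> W)
    (u : powerseries U) (v : powerseries V) (N n : nat) : (n <= N)%N ->
  conv b u v n =
  \sum_(i < N.+1) \sum_(j < N.+1 | (i + j == n)%N) b (u i) (v j).
Proof.
move=> nN; rewrite /conv (big_ord_widen N.+1 (fun i => b (u i) (v (n - i)%N))) //.
rewrite big_mkcond /=; apply: eq_bigr => i _; case: ifP => [lin|lin].
  have jN : (n - i < N.+1)%N by rewrite ltnS (leq_trans (leq_subr _ _)).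
  rewrite (big_pred1 (Ordinal jN)) // => j /=.
  apply/eqP/eqP => [e|->]; last by rewrite /= subnKC.
  by apply: val_inj; rewrite /= -e addKn.
rewrite big_pred0 // => j; apply/negP => /eqP e.
by move: lin; rewrite -e ltnS leq_addr.
Qed.

Lemma conv_convr (U V W X Y : nmodType) (a : U -> X -> Y) (b : V -> W -> X)
    (u : powerseries U) (v : powerseries V) (w : powerseries W) (n : nat) :
  (forall x, a x 0 = 0) -> (forall x, {morph a x : y z / y + z}) ->
  conv a u (conv b v w) n =
  \sum_(i < n.+1) \sum_(j < n.+1) \sum_(l < n.+1 | (i + j + l == n)%N)
    a (u i) (b (v j) (w l)).
Proof.
move=> a0 aD; rewrite (convE _ _ _ (leqnn n)); apply: eq_bigr => i _.
transitivity (\sum_(m < n.+1 | (i + m == n)%N) \sum_(j < n.+1)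
    \sum_(l < n.+1 | (j + l == m)%N) a (u i) (b (v j) (w l))).
  apply: eq_bigr => m _; rewrite (convE _ _ _ (leq_ord m)) (big_morph _ (aD _) (a0 _)).
  by apply: eq_bigr => j _; rewrite (big_morph _ (aD _) (a0 _)).
rewrite exchange_big; apply: eq_bigr => j _ /=.
rewrite (exchange_big_dep (fun l : 'I_n.+1 => (i + j + l == n)%N)) /=; last first.
  by move=> m l /eqP e /eqP jlm; rewrite -addnA jlm e.
apply: eq_bigr => l /eqP e.
have jl : (j + l < n.+1)%N by rewrite ltnS -[X in (_ <= X)%N]e -addnA leq_addl.
rewrite (big_pred1 (Ordinal jl)) // => m /=.
apply/andP/eqP => [[_ /eqP jlm]|->]; last by rewrite /= addnA e !eqxx.
exact: val_inj.
Qed.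

Lemma conv_convl (U V W X Y : nmodType) (a : X -> W -> Y) (b : U -> V -> X)
    (u : powerseries U) (v : powerseries V) (w : powerseries W) (n : nat) :
  (forall y, a 0 y = 0) -> (forall y, {morph a^~ y : x z / x + z}) ->
  conv a (conv b u v) w n =
  \sum_(i < n.+1) \sum_(j < n.+1) \sum_(l < n.+1 | (i + j + l == n)%N)
    a (b (u i) (v j)) (w l).
Proof.
move=> a0 aD; rewrite (convE _ _ _ (leqnn n)).
transitivity (\sum_(m < n.+1) \sum_(l < n.+1 | (m + l == n)%N) \sum_(i < n.+1)
    \sum_(j < n.+1 | (i + j == m)%N) a (b (u i) (v j)) (w l)).
  apply: eq_bigr => m _; apply: eq_bigr => l _.
  rewrite (convE _ _ _ (leq_ord m)) (big_morph (a^~ (w l)) (aD _) (a0 _)).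
  by apply: eq_bigr => i _; rewrite (big_morph (a^~ (w l)) (aD _) (a0 _)).
under eq_bigr => m _ do rewrite exchange_big /=.
rewrite exchange_big /=; apply: eq_bigr => i _.
transitivity (\sum_(m < n.+1) \sum_(j < n.+1 | (i + j == m)%N)
    \sum_(l < n.+1 | (m + l == n)%N) a (b (u i) (v j)) (w l)).
  by apply: eq_bigr => m _; rewrite exchange_big.
rewrite (exchange_big_dep predT) //=; apply: eq_bigr => j _.
have [lt|ge] := ltnP (i + j) n.+1; last first.
  rewrite big_pred0; last by move=> m; apply/eqP => e; have := ltn_ord m; rewrite -e ltnNge ge.
  rewrite big_pred0 // => l; apply/eqP => e.
  by have := leq_addr l (i + j)%N; rewrite e leqNgt ge.
rewrite (big_pred1 (Ordinal lt)) //.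
Qed.

Lemma conv_flip (U V : Type) (W : nmodType) (b : U -> V -> W)
    (u : powerseries U) (v : powerseries V) :
  conv b u v = conv (fun y x => b x y) v u.
Proof.
apply/funext => n; rewrite !(convE _ _ _ (leqnn n)).
under eq_bigr do rewrite big_mkcond.
rewrite exchange_big /=; apply: eq_bigr => j _.
by rewrite [RHS]big_mkcond; apply: eq_bigr => i _; rewrite addnC.
Qed.

HB.instance Definition _ (V : Type) := gen_eqMixin (powerseries V).
HB.instance Definition _ (V : Type) := gen_choiceMixin (powerseries V).

Definition ps_add (V : nmodType) (u v : powerseries V) : powerseries V :=
  fun n => u n + v n.
Definition ps_opp (V : zmodType) (u : powerseries V) : powerseries V :=
  fun n => - u n.

Lemma ps_addA (V : nmodType) : associative (@ps_add V).
Proof. by move=> u v w; apply/funext => n; rewrite /ps_add addrA. Qed.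

Lemma ps_addC (V : nmodType) : commutative (@ps_add V).
Proof. by move=> u v; apply/funext => n; rewrite /ps_add addrC. Qed.

Lemma ps_add0 (V : nmodType) : left_id (fun=> 0) (@ps_add V).
Proof. by move=> u; apply/funext => n; rewrite /ps_add add0r. Qed.

HB.instance Definition _ (V : nmodType) :=
  GRing.isNmodule.Build (powerseries V)
    (@ps_addA V) (@ps_addC V) (@ps_add0 V).

Lemma ps_addN (V : zmodType) : left_inverse 0 (@ps_opp V) +%R.
Proof. by move=> u; apply/funext => n; exact: addNr. Qed.

HB.instance Definition _ (V : zmodType) :=
  GRing.Nmodule_isZmodule.Build (powerseries V) (@ps_addN V).

Lemma psD (V : nmodType) (u v : powerseries V) n : (u + v) n = u n + v n.
Proof. by []. Qed.

Lemma conv_constl (U V : nmodType) (W : nmodType) (b : U -> V -> W) (x : U)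
    (v : powerseries V) :
  (forall y, b 0 y = 0) -> conv b (constps x) v = fun n => b x (v n).
Proof.
move=> b0; apply/funext => n; rewrite /conv big_ord_recl /= subn0.
by rewrite big1 ?addr0 // => i _; rewrite b0.
Qed.

Lemma conv_Dl (U V W : nmodType) (b : U -> V -> W) (u u' : powerseries U)
    (v : powerseries V) : (forall y, {morph b^~ y : x z / x + z}) ->
  conv b (u + u') v = conv b u v + conv b u' v.
Proof.
move=> bD; apply/funext => n; rewrite psD /conv -big_split.
by apply: eq_bigr => i _; rewrite psD bD.
Qed.

Lemma conv_Dr (U V W : nmodType) (b : U -> V -> W) (u : powerseries U)
    (v v' : powerseries V) : (forall x, {morph b x : y z / y + z}) ->
  conv b u (v + v') = conv b u v + conv b u v'.
Proof.
move=> bD; apply/funext => n; rewrite psD /conv -big_split.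
by apply: eq_bigr => i _; rewrite psD bD.
Qed.

Definition ps_mul (R : comNzRingType) : powerseries R -> powerseries R ->
  powerseries R := conv *%R.

Lemma ps_mulA (R : comNzRingType) : associative (@ps_mul R).
Proof.
move=> u v w; apply/funext => n; rewrite /ps_mul.
rewrite conv_convr; [|exact: mulr0|exact: mulrDr].
rewrite conv_convl; [|exact: mul0r|by move=> y x z; exact: mulrDl].
by do 3!apply: eq_bigr => ? _; rewrite mulrA.
Qed.

Lemma ps_mulC (R : comNzRingType) : commutative (@ps_mul R).
Proof.
move=> u v; rewrite /ps_mul [LHS]conv_flip.
by apply/funext => n; apply: eq_bigr => i _; rewrite mulrC.
Qed.

Lemma ps_mul1 (R : comNzRingType) : left_id (constps 1) (@ps_mul R).
Proof.
move=> u; rewrite /ps_mul conv_constl; last exact: mul0r.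
by apply/funext => n; rewrite mul1r.
Qed.

Lemma ps_mulDl (R : comNzRingType) : left_distributive (@ps_mul R) +%R.
Proof. by move=> u v w; rewrite /ps_mul conv_Dl // => y x z; rewrite mulrDl. Qed.

Lemma ps_1neq0 (R : comNzRingType) : constps (1 : R) != 0.
Proof. by apply/eqP => /(congr1 (@^~ 0%N)) /eqP; rewrite oner_eq0. Qed.

(* R[[t]], with the Cauchy product (not the pointwise product of nat -> R). *)
HB.instance Definition _ (R : comNzRingType) :=
  GRing.Zmodule_isComNzRing.Build (powerseries R)
    (@ps_mulA R) (@ps_mulC R) (@ps_mul1 R) (@ps_mulDl R) (@ps_1neq0 R).

Definition ps_scale (R : comNzRingType) (V : lmodType R) :
  powerseries R -> powerseries V -> powerseries V := conv *:%R.

Lemma ps_scaleA (R : comNzRingType) (V : lmodType R) (a b : powerseries R)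
  (v : powerseries V) : ps_scale a (ps_scale b v) = ps_scale (a * b) v.
Proof.
apply/funext => n; rewrite /ps_scale.
rewrite conv_convr; [|exact: scaler0|exact: scalerDr].
rewrite conv_convl; [|exact: scale0r|by move=> y x z; exact: scalerDl].
by do 3!apply: eq_bigr => ? _; rewrite scalerA.
Qed.

Lemma ps_scale1 (R : comNzRingType) (V : lmodType R) :
  left_id 1 (@ps_scale R V).
Proof.
move=> u; rewrite /ps_scale conv_constl; last exact: scale0r.
by apply/funext => n; rewrite scale1r.
Qed.

Lemma ps_scaleDr (R : comNzRingType) (V : lmodType R) :
  right_distributive (@ps_scale R V) +%R.
Proof. by move=> a u v; rewrite /ps_scale conv_Dr // => x y z; exact: scalerDr. Qed.

Lemma ps_scaleDl (R : comNzRingType) (V : lmodType R) (v : powerseries V) :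
  {morph (@ps_scale R V)^~ v : a b / a + b}.
Proof. by move=> a b; rewrite /ps_scale conv_Dl // => y x z; exact: scalerDl. Qed.

HB.instance Definition _ (R : comNzRingType) (V : lmodType R) :=
  GRing.Zmodule_isLmodule.Build (powerseries R) (powerseries V)
    (@ps_scaleA R V) (@ps_scale1 R V) (@ps_scaleDr R V) (@ps_scaleDl R V).

Lemma linear_morphD (R : comNzRingType) (V W : lmodType R) (f : V -> W) :
  linear f -> {morph f : x y / x + y}.
Proof. by move=> lf x y; have := lf 1 x y; rewrite !scale1r. Qed.

Lemma linear_morph0 (R : comNzRingType) (V W : lmodType R) (f : V -> W) :
  linear f -> f 0 = 0.
Proof. by move=> lf; apply: (addIr (f 0)); rewrite -linear_morphD // !add0r. Qed.

Lemma linear_morphZ (R : comNzRingType) (V W : lmodType R) (f : V -> W) :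
  linear f -> forall a, {morph f : x / a *: x}.
Proof.
by move=> lf a x; have := lf a x 0; rewrite !addr0 linear_morph0 // addr0.
Qed.

Lemma conv_linearr (R : comNzRingType) (U : nmodType) (V W : lmodType R)
    (b : U -> V -> W) (u : powerseries U) :
  (forall x, linear (b x)) -> linear (conv b u).
Proof.
move=> bl a v w; rewrite conv_Dr; last by move=> x; exact: linear_morphD.
congr (_ + _); apply/funext => n.
have bD x := linear_morphD (bl x); have b0 x := linear_morph0 (bl x).
rewrite [RHS]/(conv _ _ _ _).
rewrite (@conv_convr _ _ _ _ _ b *:%R) //.
rewrite -[RHS]/(conv *:%R a (conv b u v) n).
rewrite conv_convr; [|exact: scaler0|exact: scalerDr].
rewrite [RHS]exchange_big; apply: eq_bigr => i _; apply: eq_bigr => j _.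
by rewrite addnC; apply: eq_bigr => l _; rewrite linear_morphZ.
Qed.

Lemma conv_linearl (R : comNzRingType) (U V W : lmodType R)
    (b : U -> V -> W) (v : powerseries V) :
  (forall y, linear (b^~ y)) -> linear ((conv b)^~ v).
Proof.
move=> bl a u w; rewrite ![conv b _ v]conv_flip.
exact: (conv_linearr (b := fun y x => b x y)).
Qed.

Lemma conv_bilinear (R : comNzRingType) (U V W : lmodType R)
    (b : U -> V -> W) :
  bilinear_for *:%R *:%R b -> bilinear_for *:%R *:%R (conv b).
Proof.
by move=> [bl br]; split => u; [exact: conv_linearl | exact: conv_linearr].
Qed.

Lemma conv_idlr (R : comNzRingType) (U V W X Y Z T : lmodType R)
    (a : U -> X -> T) (b : V -> W -> X) (c : Y -> W -> T) (d : U -> V -> Y)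
    (e : V -> Z -> T) (f : U -> W -> Z) (s : T -> T)  :
  (forall x, linear (a x)) -> (forall y, linear (c^~ y)) ->
  (forall x, linear (e x)) -> linear s ->
  (forall x y z, a x (b y z) = c (d x y) z + s (e y (f x z))) ->
  forall u v w n, conv a u (conv b v w) n =
    conv c (conv d u v) w n + s (conv e v (conv f u w) n).
Proof.
move=> la lc le ls id u v w n.
rewrite conv_convr; [|by move=> ?; exact: linear_morph0|by move=> ?; exact: linear_morphD].
rewrite conv_convl; [|by move=> y; exact: (linear_morph0 (lc y))|by move=> y; exact: (linear_morphD (lc y))].
rewrite conv_convr; [|by move=> ?; exact: linear_morph0|by move=> ?; exact: linear_morphD].
rewrite [X in s X]exchange_big /= (big_morph s (linear_morphD ls) (linear_morph0 ls)).
rewrite -big_split; apply: eq_bigr => i _ /=.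
rewrite (big_morph s (linear_morphD ls) (linear_morph0 ls)).
rewrite -big_split; apply: eq_bigr => j _ /=.
under [X in s X]eq_bigl => l do rewrite (addnC j i).
rewrite (big_morph s (linear_morphD ls) (linear_morph0 ls)).
by rewrite -big_split; apply: eq_bigr.
Qed.

Lemma bracket_linearl (R : comNzRingType) (g : leibnizType R) (y : g) :
  linear (bracket^~ y).
Proof. exact: (bracket_bilinear (s := g)).1. Qed.

Lemma bracket_linearr (R : comNzRingType) (g : leibnizType R) (x : g) :
  linear (bracket x).
Proof. exact: (bracket_bilinear (s := g)).2. Qed.

Lemma id_linear (R : comNzRingType) (V : lmodType R) : linear (@id V).
Proof. by []. Qed.

Lemma opp_linear (R : comNzRingType) (V : lmodType R) :
  linear (-%R : V -> V).
Proof. by move=> a x y; rewrite opprD scalerN. Qed.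

Lemma ps_bracket_leibniz (R : comNzRingType) (g : leibnizType R)
    (x y z : powerseries g) :
  conv bracket x (conv bracket y z) =
  conv bracket (conv bracket x y) z + conv bracket y (conv bracket x z).
Proof.
apply/funext => n; rewrite psD.
rewrite (conv_idlr (b := bracket) (c := bracket) (d := bracket) (e := bracket)
  (f := bracket) (s := id)) //; try by move=> ?; exact: bracket_linearr.
  by move=> ?; exact: bracket_linearl.
exact: bracket_leibniz.
Qed.

HB.instance Definition _ (R : comNzRingType) (g : leibnizType R) :=
  Lmodule_isLeibniz.Build (powerseries R) (powerseries g)
    (conv_bilinear (bracket_bilinear (s := g)))
    (@ps_bracket_leibniz R g).

Lemma ps_is_representation (R : comNzRingType) (g : leibnizType R)
    (V : lmodType R) (rL rR : g -> V -> V) :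
  is_representation rL rR -> is_representation (conv rL) (conv rR).
Proof.
move=> [bL bR e1 e2 e3].
split; [exact: conv_bilinear|exact: conv_bilinear|..] => x y v; apply/funext => n.
- apply/eqP; rewrite -[X in _ == X]/(conv rL x (conv rL y v) n - conv rL y (conv rL x v) n).
  rewrite eq_sym subr_eq; apply/eqP.
  apply: (conv_idlr (s := id)) => //; try exact: bL.2; first exact: bL.1.
  by move=> {}x {}y {}v; rewrite e1 subrK.
- apply/eqP; rewrite -[X in _ == X]/(conv rL x (conv rR y v) n - conv rR y (conv rL x v) n).
  rewrite eq_sym subr_eq; apply/eqP.
  apply: (conv_idlr (s := id)) => //; [exact: bL.2|exact: bR.1|exact: bR.2|].
  by move=> {}x {}y {}v; rewrite e2 subrK.
- apply/eqP; rewrite -[X in _ == X]/(conv rL x (conv rR y v) n + conv rR y (conv rR x v) n).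
  rewrite eq_sym -[X in _ + X]opprK subr_eq; apply/eqP.
  apply: (conv_idlr (s := -%R)) => //; [exact: bL.2|exact: bR.1|exact: bR.2|exact: opp_linear|].
  by move=> {}x {}y {}v; rewrite e3 addrK.
Qed.

Lemma ps_rhoL_bracket (R : comNzRingType) (g h : leibnizType R)
    (rho : leibniz_rep g h) (x : powerseries g) (u v : powerseries h) :
  conv (rhoL rho) x ⟦u, v⟧ =
  ⟦conv (rhoL rho) x u, v⟧ + ⟦u, conv (rhoL rho) x v⟧.
Proof.
case: (leibniz_rep_is_rep rho) => bL _ _ _ _.
apply/funext => n; apply: (conv_idlr (s := id)) => //.
- exact: bL.2.
- exact: bracket_linearl.
- exact: bracket_linearr.
- exact: rhoL_bracket.
Qed.

Lemma ps_bracket_rhoR (R : comNzRingType) (g h : leibnizType R)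
    (rho : leibniz_rep g h) (x : powerseries g) (u v : powerseries h) :
  ⟦u, conv (rhoR rho) x v⟧ =
  conv (rhoR rho) x ⟦u, v⟧ + ⟦v, conv (rhoR rho) x u⟧.
Proof.
case: (leibniz_rep_is_rep rho) => _ bR _ _ _.
have -> : ⟦v, conv (rhoR rho) x u⟧ =
    conv (fun p q => ⟦q, p⟧) (conv (fun w y => rhoR rho y w) u x) v.
  by rewrite -(conv_flip (rhoR rho)) -(conv_flip bracket).
rewrite addrC.
apply/funext => n; apply: (conv_idlr (s := id)) => //.
- exact: bracket_linearr.
- exact: bracket_linearr.
- exact: bR.2.
- by move=> y z w; rewrite bracket_rhoR addrC.
Qed.

Lemma ps_bracket_rhoL (R : comNzRingType) (g h : leibnizType R)
    (rho : leibniz_rep g h) (x : powerseries g) (u v : powerseries h) :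
  ⟦u, conv (rhoL rho) x v⟧ =
  ⟦conv (rhoR rho) x u, v⟧ + conv (rhoL rho) x ⟦u, v⟧.
Proof.
case: (leibniz_rep_is_rep rho) => bL _ _ _ _.
rewrite (conv_flip (rhoR rho)).
apply/funext => n; apply: (conv_idlr (s := id)) => //.
- exact: bracket_linearr.
- exact: bracket_linearl.
- exact: bL.2.
- by move=> y z w; rewrite bracket_rhoL.
Qed.

Definition ps_rep (R : comNzRingType) (g h : leibnizType R)
    (rho : leibniz_rep g h) : leibniz_rep (powerseries g) (powerseries h) :=
  LeibnizRep (ps_is_representation (leibniz_rep_is_rep rho))
    (@ps_rhoL_bracket R g h rho) (@ps_bracket_rhoR R g h rho)
    (@ps_bracket_rhoL R g h rho).

(* The map V[[t]] -> W[[t]] induced by an element of Hom(V, W)[[t]]. *)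
Definition ps_hom (R : comNzRingType) (V W : lmodType R)
    (F : powerseries {linear V -> W}) : powerseries V -> powerseries W :=
  conv (fun (f : {linear V -> W}) v => f v) F.

Definition tvar (R : comNzRingType) : powerseries R :=
  fun n => (n == 1%N)%:R.

(* The map id + t f on V[[t]], with f extended coefficientwise. *)
Definition id_plus_t (R : comNzRingType) (V : lmodType R) (f : V -> V)
    : powerseries V -> powerseries V :=
  fun u => u + tvar R *: (f \o u : powerseries V).

Definition is_formal_deformation (R : comNzRingType) (g h : leibnizType R)
    (rho : leibniz_rep g h) (H : g -> h)
    (Ht : powerseries {linear g -> h}) : Prop :=
  Ht 0%N =1 H /\ is_crossed_hom (ps_rep rho) (ps_hom Ht).

Definition equivalent_deformations (R : comNzRingType) (g h : leibnizType R)
    (rho : leibniz_rep g h) (Ht Ht' : powerseries {linear g -> h}) : Prop :=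
  exists x : g,
    is_crossed_hom_morphism (ps_rep rho) (ps_hom Ht) (ps_hom Ht')
      (id_plus_t (bracket x)) (id_plus_t (rhoL rho x)).

(* Main.v *)
(* Everything is read off from the coefficient of t. Applied to constant series,
   the crossed homomorphism equation for H_t gives in degree 1 the cocycle
   equation for H_1. Comparing the coefficients of t in psi_t H_t y = H'_t phi_t y
   gives H_1 y + rhoL x (H y) = H'_1 y + H [x, y], and expanding H [x, y] turns
   this into H_1 - H'_1 = d_H (H x), with H x in h viewed as a 0-cochain. *)

Require Import Defs.
From mathcomp Require Import all_boot all_algebra.
From mathcomp Require Import boolp classical_sets functions.

Set Implicit Arguments.
Unset Strict Implicit.
Unset Printing Implicit Defensive.

Import GRing.Theory.
Local Open Scope ring_scope.

Lemma conv0 (U V : Type) (W : nmodType) (b : U -> V -> W)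
    (u : powerseries U) (v : powerseries V) : conv b u v 0%N = b (u 0%N) (v 0%N).
Proof. by rewrite /conv big_ord1. Qed.

Lemma conv1 (U V : Type) (W : nmodType) (b : U -> V -> W)
    (u : powerseries U) (v : powerseries V) :
  conv b u v 1%N = b (u 0%N) (v 1%N) + b (u 1%N) (v 0%N).
Proof. by rewrite /conv !big_ord_recl big_ord0 addr0. Qed.

Lemma ps_bracketE (R : comNzRingType) (g : leibnizType R)
    (u v : powerseries g) : ⟦u, v⟧ = conv bracket u v.
Proof. by []. Qed.

(** Scaling of power series is itself a [conv], so the low-degree formulas for [conv] apply to the
    [tvar] term. *)
Lemma id_plus_t0 (R : comNzRingType) (V : lmodType R) (f : V -> V)
    (u : powerseries V) : id_plus_t f u 0%N = u 0%N.
Proof. by rewrite /id_plus_t psD [X in _ + X]conv0 scale0r addr0. Qed.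

Lemma id_plus_t1 (R : comNzRingType) (V : lmodType R) (f : V -> V)
    (u : powerseries V) : id_plus_t f u 1%N = u 1%N + f (u 0%N).
Proof.
by rewrite /id_plus_t psD [X in _ + X]conv1 scale0r add0r scale1r.
Qed.

Section LowDegreeCoboundary.

Variables (R : comNzRingType) (g h : leibnizType R) (rho : leibniz_rep g h).
Variable H : g -> h.

Lemma rhoRH_linear (x : g) : linear (rhoRH rho H x).
Proof.
case: (leibniz_rep_is_rep rho) => _ [_ rhoR_lin] _ _ _ a u v.
by rewrite /rhoRH rhoR_lin bracket_linearl scalerDr addrACA.
Qed.

(** Both sums of [delta_leib] are empty, and the sign in [dH] cancels the one before [rhoRH]. *)
Lemma dH_cochain0 (f : cochain g h 0) (x : 'I_1 -> g) :
  dH rho H f x = rhoRH rho H (x ord_max) (f (fun k => x (lift ord_max k))).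
Proof.
rewrite /dH /delta_leib big_pred0 // big_ord1 big_pred0; last first.
  by move=> j; rewrite (ord1 j).
by rewrite add0r addr0 scalerA -expr2 sqrr_sign scale1r.
Qed.

Lemma dH_cochain1 (f : g -> h) (x : 'I_2 -> g) :
  dH rho H (cochain1 f) x =
  rhoLH rho H (x ord0) (f (x ord_max)) + rhoRH rho H (x ord_max) (f (x ord0))
  - f ⟦x ord0, x ord_max⟧.
Proof.
have lift0 : lift ord0 ord0 = ord_max :> 'I_2 by exact: val_inj.
have liftm : lift ord_max ord0 = ord0 :> 'I_2 by exact: val_inj.
rewrite /dH /delta_leib /cochain1 sqrrN expr1n !scale1r liftm.
rewrite big_mkcond !big_ord_recl !big_ord0 /= !addr0 expr0 scale1r lift0.
rewrite !big_mkcond !big_ord_recl !big_ord0 /= !lift0.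
(* For [i] equal to 1 no index [j] is larger. *)
rewrite big_pred0; first by rewrite !addr0 add0r expr1 scaleN1r.
by case=> -[|[|]].
Qed.

Lemma multilinear_cochain1 (f : g -> h) : linear f -> multilinear (cochain1 f).
Proof. by move=> lin_f i x a u v; rewrite (ord1 i); exact: lin_f. Qed.

(** The difference of [f] and [f'] is the coboundary of [v] as a 0-cochain, so shifting 0-cochains
    by [v] carries one coset to the other. *)
Lemma cohomology_class_cochain1 (f f' : g -> h) (v : h) :
  (forall y, f y = f' y + rhoRH rho H y v) ->
  cohomology_class rho H (cochain1 f) = cohomology_class rho H (cochain1 f').
Proof.
move=> ff'; apply/seteqP; split=> _ /= [_ [c _ <-] <-].
  (* Multilinearity of a 0-cochain is vacuous, since ['I_0] is empty. *)
  exists (dH rho H (fun z => v + c z)); first by exists (fun z => v + c z) => // -[].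
  apply/funext => x; rewrite /cochain1 ff' !dH_cochain0.
  by rewrite (linear_morphD (rhoRH_linear _)) !ord1 addrA.
exists (dH rho H (fun z => c z - v)); first by exists (fun z => c z - v) => // -[].
apply/funext => x; rewrite /cochain1 ff' !dH_cochain0 !ord1 -addrA.
by rewrite -(linear_morphD (rhoRH_linear _)) [v + _]addrC subrK.
Qed.

End LowDegreeCoboundary.

Section Deformations.

Variables (R : comNzRingType) (g h : leibnizType R) (rho : leibniz_rep g h).
Variable H : g -> h.

(** The bracket of [H_t x] and [H_t y] contributes [⟦H x, H_1 y⟧] and [⟦H_1 x, H y⟧] in degree 1;
    these twist [rhoL] and [rhoR] into [rhoLH] and [rhoRH]. *)
Lemma formal_deformation_bracket1 (Ht : powerseries {linear g -> h}) (x y : g) :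
  is_formal_deformation rho H Ht ->
  Ht 1%N ⟦x, y⟧ = rhoLH rho H x (Ht 1%N y) + rhoRH rho H y (Ht 1%N x).
Proof.
case: (leibniz_rep_is_rep rho) => -[rhoL0 _] [rhoR0 _] _ _ _ [H0 [_ Ht_bracket]].
have := congr1 (@^~ 1%N) (Ht_bracket (constps x) (constps y)).
rewrite !psD /ps_hom /= !ps_bracketE !conv1 !conv0 /= !linear0 !H0.
rewrite (linear_morph0 (rhoL0 _)) (linear_morph0 (rhoR0 _)).
rewrite (linear_morph0 (bracket_linearr _)) (linear_morph0 (bracket_linearl _)).
(* That [H] vanishes at 0 comes from the linearity of [Ht 0]. *)
by rewrite !addr0 -H0 linear0 !add0r addrACA.
Qed.

Lemma equivalent_deformations1 (Ht Ht' : powerseries {linear g -> h}) :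
  is_crossed_hom rho H ->
  is_formal_deformation rho H Ht -> is_formal_deformation rho H Ht' ->
  equivalent_deformations rho Ht Ht' ->
  exists x : g, forall y, Ht 1%N y = Ht' 1%N y + rhoRH rho H y (H x).
Proof.
move=> [_ H_bracket] [H0 _] [H0' _] [x [_ _ comm _ _]]; exists x => y.
have := congr1 (@^~ 1%N) (comm (constps y)).
rewrite /= id_plus_t1 /ps_hom !conv1 conv0 id_plus_t0 id_plus_t1 /=.
rewrite !linear0 !add0r H0 H0' H_bracket => e.
(* The summand [rhoL rho x (H y)] of [H ⟦x, y⟧] also stands on the left of [e] and cancels; the
   other two form [rhoRH rho H y (H x)]. *)
apply: (addIr (rhoL rho x (H y))); rewrite /rhoRH.
by rewrite e -[L in L + _]addrA [L in L + _]addrC addrC addrA.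
Qed.

End Deformations.

Theorem proposition4p8 (k : fieldType) (k_char0 : [pchar k] =i pred0)
    (g h : leibnizType k) (rho : leibniz_rep g h)
    (H : g -> h) (H_crossed : is_crossed_hom rho H)
    (Ht : powerseries {linear g -> h})
    (Ht_deformation : is_formal_deformation rho H Ht) :
  cocycles rho H 1 (cochain1 (Ht 1%N)) /\
  (forall Ht' : powerseries {linear g -> h},
     is_formal_deformation rho H Ht' ->
     equivalent_deformations rho Ht Ht' ->
     cohomology_class rho H (cochain1 (Ht 1%N)) =
     cohomology_class rho H (cochain1 (Ht' 1%N))).
Proof.
split.
  split; first by apply: multilinear_cochain1; exact: linearP.
  (* The last term of [dH] becomes the sum of the first two. *)
  move=> x; rewrite dH_cochain1 (formal_deformation_bracket1 _ _ Ht_deformation).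
  exact: subrr.
move=> Ht' Ht'_deformation equiv.
have [x e] := equivalent_deformations1 H_crossed Ht_deformation Ht'_deformation equiv.
exact: cohomology_class_cochain1 e.
Qed.
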